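(* Let $k$ be a field, let $f_1\mid f_2\mid\cdots\mid f_m$ be monic non-zero polynomials in $k[x]$, put $n_i=\deg f_i$ and $n=n_1+\cdots+n_m$, and let $A=C(f_1)\oplus\cdots\oplus C(f_m)\in M_n(k)$. Let $Q_{ij}$ ($1\le i,j\le m$) be the generating matrices of $f_1,\dots,f_m$ defined in the context. Then every element of $C_{M_n(k)}(A)$ has a decomposition as a block matrix $$\begin{bmatrix} C_{11}&C_{12}&\cdots&C_{1m}\\ C_{21}&C_{22}&\cdots&C_{2m}\\ \vdots&&\ddots&\vdots\\ C_{m1}&C_{m2}&\cdots&C_{mm}\end{bmatrix},$$ where $C_{ij}\in M_{n_i,n_j}(k)$ and $C_{ij}$ depends on the choice of $\phi_{ij}\in\operatorname{Hom}_{k[x]}\big(k[x]/f_jk[x],\,k[x]/f_ik[x]\big)$. More explicitly, $$C_{ij}\in\{\lambda(C(f_i))\,Q_{ij}:\lambda(x)\in k[x]\}=\operatorname{span}_k\{I,C(f_i),\ldots,C(f_i)^{n_i-1}\}\,Q_{ij}.$$ When $i>j$, the spanning family $Q_{ij},\,C(f_i)Q_{ij},\ldots,C(f_i)^{n_i-1}Q_{ij}$ on the right-hand side is not $k$-linearly independent. To make it linearly independent when $i>j$, one takes instead $\operatorname{span}_k\{I,C(f_i),\ldots,C(f_i)^{n_j-1}\}\,Q_{ij}$: this is the same space, and the family $Q_{ij},\,C(f_i)Q_{ij},\ldots,C(f_i)^{n_j-1}Q_{ij}$ is $k$-linearly independent. An explicit $k$-basis of $C_{M_n(k)}(A)$ is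 given by picking a block $C_{ij}$ from the families above and letting all other blocks be $0$; that is, for each pair $(i,j)$ and each integer $l$ with $0\le l\le n_i-1$ if $i\le j$, respectively $0\le l\le n_j-1$ if $i>j$, take the block matrix whose $(i,j)$ block is $C(f_i)^lQ_{ij}$ and whose other blocks are all $0$.
   Context: $M_n(k)$ denotes the $n\times n$ matrices over $k$ and $M_{p,q}(k)$ the $p\times q$ matrices over $k$. For $A\in M_n(k)$, $C_{M_n(k)}(A)=\{B\in M_n(k):BA=AB\}$. For square matrices, $A\oplus B$ denotes the block diagonal matrix with diagonal blocks $A$ and $B$. For a monic polynomial $f(x)=x^n+c_{n-1}x^{n-1}+\cdots+c_0\in k[x]$, the companion matrix $C(f)\in M_n(k)$ is the matrix whose $s$-th column is the standard basis vector $e_{s+1}$ for $1\le s\le n-1$ and whose last column is $(-c_0,-c_1,\ldots,-c_{n-1})^{T}$. Write $V_{C(f)}$ for the $k[x]$-module $k^n$ on which $x$ acts by $x\cdot v=C(f)v$. Let $f_1\mid\cdots\mid f_m$ be monic non-zero polynomials in $k[x]$ and $n_i=\deg f_i$. Let $T_i:V_{C(f_i)}\to k[x]/f_ik[x]$ be the $k[x]$-module isomorphism with $e_s\mapsto x^{s-1}+f_ik[x]$. The dependence of $C_{ij}$ on $\phi_{ij}$ is that $C_{ij}$ is the matrix representation of the $k[x]$-module homomorphism $V_{C(f_j)}\to V_{C(f_i)}$, $v\mapsto T_i^{-1}(\phi_{ij}(T_j(v)))$. Generating polynomial: $q_{ij}(x)=1$ if $i\le j$, and $q_{ij}(x)=f_i/f_j$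 if $i>j$. Generating vector (denoted by the same letter): $q_{ij}=T_i^{-1}\big(q_{ij}(x)+f_ik[x]\big)\in k^{n_i}$. Generating matrix: $Q_{ij}\in M_{n_i,n_j}(k)$ is the matrix whose $s$-th column is $C(f_i)^{s-1}q_{ij}$ for $1\le s\le n_j$, that is, $Q_{ij}=[\,q_{ij}\mid C(f_i)q_{ij}\mid\cdots\mid C(f_i)^{n_j-1}q_{ij}\,]$. For a set $S$ of $n_i\times n_i$ matrices, $\operatorname{span}_k(S)\,Q_{ij}$ denotes $\{MQ_{ij}:M\in\operatorname{span}_k(S)\}$.
   Formalization: For i>j, the claim that the family Q_ij, …, C(f_i)^{n_i-1}Q_ij is not linearly independent is stated only when f_i ≠ f_j; if f_i = f_j then Q_ij = I and the family I, …, C(f_i)^{n_i-1} is independent (e.g. f_1 = f_2 = x). *)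

(* Defs.v *)
From HB Require Import structures.
From mathcomp Require Import all_boot all_algebra.

Set Implicit Arguments.
Unset Strict Implicit.
Unset Printing Implicit Defensive.

Import GRing.Theory.
Local Open Scope ring_scope.
Local Open Scope quotient_scope.

(* [companionmx f] has the coefficients of [f] in its last row; here they are
   in the last column (see [companion_colS] and [companion_col_last]).
   The matrix is empty when [f = 1]. *)
Definition companion (k : fieldType) (f : {poly k}) : 'M[k]_((size f).-1) :=
  (companionmx f)^T.

Lemma companion_colS (k : fieldType) (f : {poly k}) (s t : 'I_((size f).-1)) :
  t = s.+1 :> nat -> col s (companion f) = delta_mx t 0.
Proof.
move=> ts; apply/colP => r; rewrite !mxE eqxx andbT ifF; last first.
  apply/negbTE; rewrite neq_ltn -ltnS -ts prednK ?ltn_ord //.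
  exact: leq_ltn_trans (ltn_ord s).
by rewrite -ts eq_sym -val_eqE.
Qed.

Lemma companion_col_last (k : fieldType) (f : {poly k}) (s : 'I_((size f).-1)) :
  s = (size f).-2 :> nat -> col s (companion f) = \col_r - f`_r.
Proof. by move=> se; apply/colP => r; rewrite !mxE se eqxx. Qed.

(* [horner_mx] is restricted to matrices of size [n.+1]; companion matrices of
   constant polynomials have size 0. *)
Definition polymx (k : fieldType) n (A : 'M[k]_n) (p : {poly k}) : 'M[k]_n :=
  \sum_(l < size p) p`_l *: A ^+ l.

Lemma polymxE (k : fieldType) n (A : 'M[k]_n.+1) p : polymx A p = horner_mx A p.
Proof.
rewrite -{2}[p]coefK poly_def rmorph_sum /=; apply: eq_bigr => l _.
by rewrite linearZ /= rmorphXn /= horner_mx_X.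
Qed.

Section PolymxTheory.
Variables (k : fieldType) (n : nat) (A : 'M[k]_n).

Lemma polymxM p q : polymx A (p * q) = polymx A p *m polymx A q.
Proof.
case: n A => [|n'] B; first by rewrite !flatmx0.
by rewrite !polymxE rmorphM.
Qed.

Lemma polymxD p q : polymx A (p + q) = polymx A p + polymx A q.
Proof.
case: n A => [|n'] B; first by rewrite !flatmx0.
by rewrite !polymxE rmorphD.
Qed.

Lemma polymx1 : polymx A 1 = 1%:M.
Proof.
case: n A => [|n'] B; first by rewrite !flatmx0.
by rewrite !polymxE rmorph1.
Qed.

Lemma polymxC c : polymx A c%:P = c%:M.
Proof.
case: n A => [|n'] B; first by rewrite !flatmx0.
by rewrite !polymxE horner_mx_C.
Qed.

Lemma polymxX : polymx A 'X = A.
Proof.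
case: n A => [|n'] B; first by rewrite !flatmx0.
by rewrite !polymxE horner_mx_X.
Qed.

End PolymxTheory.

Section CompanionModule.
Variables (k : fieldType) (f : {poly k}).

(* V_{C(f)}: column vectors, with p acting by p(C(f)). *)
Definition compmod : Type := 'cV[k]_((size f).-1).
HB.instance Definition _ := GRing.Zmodule.copy compmod 'cV[k]_((size f).-1).

Definition compmod_scale (p : {poly k}) (v : compmod) : compmod :=
  polymx (companion f) p *m (v : 'cV__).

Fact compmod_scaleA p q v :
  compmod_scale p (compmod_scale q v) = compmod_scale (p * q) v.
Proof. by rewrite /compmod_scale mulmxA -polymxM. Qed.

Fact compmod_scale1 : left_id 1 compmod_scale.
Proof. by move=> v; rewrite /compmod_scale polymx1 mul1mx. Qed.

Fact compmod_scaleDr : right_distributive compmod_scale +%R.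
Proof. by move=> p u v; exact: mulmxDr. Qed.

Fact compmod_scaleDl v : {morph compmod_scale^~ v : p q / p + q}.
Proof. by move=> p q; rewrite /compmod_scale polymxD; exact: mulmxDl. Qed.

HB.instance Definition _ := GRing.Zmodule_isLmodule.Build {poly k} compmod
  compmod_scaleA compmod_scale1 compmod_scaleDr compmod_scaleDl.

Lemma compmod_scaleX (v : compmod) :
  'X *: v = (companion f *m (v : 'cV__)) :> 'cV__.
Proof. by rewrite -[in RHS](polymxX (companion f)). Qed.

(* The ideal f k[x].  The library's [{poly %/ f}] is a nontrivial ring, hence
   does not give k[x]/f k[x] when [f = 1]. *)
Definition multiples : {pred {poly k}} := fun p => f %| p.

Fact multiples_zmod_closed : zmod_closed multiples.
Proof. by split=> [|p q]; [exact: dvdp0 | exact: dvdp_sub]. Qed.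

HB.instance Definition _ :=
  GRing.isZmodClosed.Build {poly k} multiples multiples_zmod_closed.

Definition polyquot : Type := {ideal_quot multiples}.
HB.instance Definition _ := GRing.Zmodule.copy polyquot {ideal_quot multiples}.

Definition polycl (p : {poly k}) : polyquot := \pi_({ideal_quot multiples}) p.

Definition polyrep (u : polyquot) : {poly k} :=
  repr (u : {ideal_quot multiples}).

Lemma polyrepK : cancel polyrep polycl.
Proof. by move=> u; rewrite /polycl /polyrep reprK. Qed.

Lemma polycl_eq p q : (polycl p == polycl q) = (f %| p - q).
Proof. by rewrite -[f %| _]/(p - q \in multiples) Quotient.idealrBE. Qed.

Fact polycl_is_zmod_morphism : zmod_morphism polycl.
Proof. by move=> p q; rewrite /polycl raddfB. Qed.
HB.instance Definition _ :=
  GRing.isZmodMorphism.Build {poly k} polyquot polycl polycl_is_zmod_morphism.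

Definition polyquot_scale (p : {poly k}) (u : polyquot) : polyquot :=
  polycl (p * polyrep u).

Lemma polyquot_scaleE p q : polyquot_scale p (polycl q) = polycl (p * q).
Proof.
apply/eqP; rewrite polycl_eq -mulrBr dvdp_mull //.
by rewrite -polycl_eq polyrepK.
Qed.

Fact polyquot_scaleA p q u :
  polyquot_scale p (polyquot_scale q u) = polyquot_scale (p * q) u.
Proof. by rewrite polyquot_scaleE mulrA. Qed.

Fact polyquot_scale1 : left_id 1 polyquot_scale.
Proof. by move=> u; rewrite /polyquot_scale mul1r polyrepK. Qed.

Fact polyquot_scaleDr : right_distributive polyquot_scale +%R.
Proof.
move=> p u v; rewrite -(polyrepK u) -(polyrepK v) -raddfD !polyquot_scaleE.
by rewrite mulrDr raddfD.
Qed.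

Fact polyquot_scaleDl u : {morph polyquot_scale^~ u : p q / p + q}.
Proof. by move=> p q; rewrite /polyquot_scale mulrDl raddfD. Qed.

HB.instance Definition _ := GRing.Zmodule_isLmodule.Build {poly k} polyquot
  polyquot_scaleA polyquot_scale1 polyquot_scaleDr polyquot_scaleDl.

Lemma polyclZ p q : p *: polycl q = polycl (p * q).
Proof. exact: polyquot_scaleE. Qed.

(* T_f sends e_s to x^(s-1) + f k[x]; [compTK], [compTinvK] and [compTZ] show
   that it is an isomorphism of k[x]-modules when f is monic. *)
Definition compT (v : compmod) : polyquot :=
  polycl (\sum_(s < (size f).-1) (v : 'cV__) s 0 *: 'X^s).

Definition compTinv (u : polyquot) : compmod :=
  \col_(r < (size f).-1) (polyrep u %% f)`_r.

Lemma compT_delta (s : 'I_((size f).-1)) : compT (delta_mx s 0) = polycl 'X^s.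
Proof.
congr polycl; rewrite (bigD1 s) //= big1 ?addr0 => [|t ts].
  by rewrite mxE !eqxx scale1r.
by rewrite mxE (negPf ts) scale0r.
Qed.

Fact compT_is_zmod_morphism : zmod_morphism compT.
Proof.
move=> u v; rewrite /compT -raddfB -sumrB; congr polycl.
by apply: eq_bigr => s _; rewrite !mxE scalerBl.
Qed.
HB.instance Definition _ :=
  GRing.isZmodMorphism.Build compmod polyquot compT compT_is_zmod_morphism.

Hypothesis f_monic : f \is monic.

Lemma compTK : cancel compT compTinv.
Proof.
move=> v; rewrite /compTinv; apply/colP => r; rewrite mxE.
set p := \sum_(s < _) (v : 'cV__) s 0 *: 'X^s.
have pE : p = \poly_(s < (size f).-1)
    (if insub s is Some i then (v : 'cV__) i 0 else 0).
  by rewrite poly_def; apply: eq_bigr => s _; rewrite valK.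
have szp : (size p < size f)%N.
  rewrite -(prednK (_ : 0 < size f)%N) ?size_poly_gt0 ?monic_neq0 // ltnS.
  by rewrite pE size_poly.
have -> : polyrep (compT v) %% f = p.
  rewrite -[RHS](modp_small szp); apply/eqP; rewrite -subr_eq0 -modpN -modpD.
  by rewrite -[_ == _]/(f %| _) -polycl_eq polyrepK.
by rewrite pE coef_poly ltn_ord valK.
Qed.

Lemma compTinvK : cancel compTinv compT.
Proof.
move=> u; rewrite -[RHS]polyrepK; apply/eqP; rewrite /compT polycl_eq.
set p := polyrep u.
have -> : \sum_(s < (size f).-1) (compTinv u : 'cV__) s 0 *: 'X^s = p %% f.
  have szp : (size (p %% f)%R <= (size f).-1)%N.
    rewrite -ltnS prednK ?size_poly_gt0 ?monic_neq0 //.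
    by rewrite ltn_modp monic_neq0.
  rewrite -[RHS]coefK poly_def.
  rewrite (big_ord_widen _ (fun i => (p %% f)`_i *: 'X^i) szp).
  rewrite [RHS]big_mkcond /=.
  apply: eq_bigr => s _; rewrite mxE; case: ifP => // /negbT.
  by rewrite -leqNgt => /(nth_default 0) ->; rewrite scale0r.
by rewrite -dvdpNr opprB {1}(divp_eq p f) addrK dvdp_mulIr.
Qed.

Lemma compTZ (p : {poly k}) (v : compmod) : compT (p *: v) = p *: compT v.
Proof.
have TC c (w : compmod) : compT (c%:P *: w) = c%:P *: compT w.
  rewrite polyclZ /compT mulr_sumr; congr polycl; apply: eq_bigr => s _.
  rewrite -[c%:P *: w]/(polymx (companion f) c%:P *m (w : 'cV__)) polymxC.
  by rewrite mul_scalar_mx mxE mul_polyC scalerA.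
have TX w : compT ('X *: w) = 'X *: compT w.
  have -> : w = \sum_s ((w : 'cV__) s 0)%:P *: (delta_mx s 0 : compmod).
    suff: w =
        \sum_s polymx (companion f) ((w : 'cV__) s 0)%:P *m delta_mx s 0 by [].
    apply/matrixP => i j; rewrite ord1 summxE (bigD1 i) //= big1 ?addr0.
      by rewrite polymxC mul_scalar_mx !mxE !eqxx mulr1.
    by move=> s si; rewrite polymxC mul_scalar_mx !mxE eq_sym (negPf si) mulr0.
  rewrite scaler_sumr !raddf_sum /=; apply: eq_bigr => s _.
  rewrite scalerA mulrC -scalerA !TC [RHS]scalerA ['X * _]mulrC -[RHS]scalerA.
  congr (_ *: _); rewrite compmod_scaleX -colE compT_delta polyclZ -exprS.
  have [sl|sl] := ltnP s.+1 (size f).-1.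
    by rewrite (@companion_colS _ _ _ (Ordinal sl)) // compT_delta.
  have sE : s.+1 = (size f).-1 by apply/eqP; rewrite eqn_leq sl ltn_ord.
  rewrite companion_col_last; last by have [] := congr1 predn sE.
  apply/eqP; rewrite polycl_eq.
  suff -> : \sum_(t < (size f).-1)
      (\col_r - f`_r : 'cV[k]_((size f).-1)) t 0 *: 'X^t - 'X^(s.+1) = - f by rewrite dvdpNr.
  have fE : f = \sum_(i < (size f).-1) f`_i *: 'X^i + 'X^(s.+1).
    transitivity (\sum_(i < (size f).-1.+1) f`_i *: 'X^i).
      by rewrite prednK ?size_poly_gt0 ?monic_neq0 // -poly_def coefK.
    by rewrite big_ord_recr /= -lead_coefE (monicP f_monic) scale1r sE.
  rewrite [in RHS]fE opprD -sumrN; congr (_ - _).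
  by apply: eq_bigr => t _; rewrite mxE scaleNr.
elim/poly_ind: p v => [|p c IH] v; first by rewrite !scale0r raddf0.
by rewrite !scalerDl raddfD /= -!scalerA IH TX TC.
Qed.

End CompanionModule.

(* Matrix of v |-> T_i^{-1} (phi (T_j v)) in the standard bases. *)
Definition hommx (k : fieldType) (fi fj : {poly k})
    (phi : {linear polyquot fj -> polyquot fi}) :
    'M[k]_((size fi).-1, (size fj).-1) :=
  \matrix_(r, s)
    (compTinv (phi (compT (delta_mx s 0 : compmod fj))) : 'cV__) r 0.

Section Generating.
Variables (k : fieldType) (m : nat) (f : 'I_m -> {poly k}).

Definition generating_poly (i j : 'I_m) : {poly k} :=
  if (i <= j)%N then 1 else f i %/ f j.

Definition generating_vec (i j : 'I_m) : 'cV[k]_((size (f i)).-1) :=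
  compTinv (polycl (f i) (generating_poly i j)).

Definition generating_mx (i j : 'I_m) :
    'M[k]_((size (f i)).-1, (size (f j)).-1) :=
  \matrix_(r, s) (companion (f i) ^+ s *m generating_vec i j) r 0.

End Generating.

Section Spaces.
Variable k : fieldType.

(* [I; A; ...; A^(d-1)] *)
Definition powers n (A : 'M[k]_n) (d : nat) : seq 'M[k]_n :=
  [seq A ^+ l | l <- iota 0 d].

Definition span_mul p q (S : seq 'M[k]_p) (Q : 'M[k]_(p, q)) :
    {vspace 'M[k]_(p, q)} :=
  (linfun (mulmxr Q) @: <<S>>)%VS.

Lemma span_mulP p q (S : seq 'M[k]_p) (Q : 'M[k]_(p, q)) (B : 'M[k]_(p, q)) :
  reflect (exists2 M, M \in <<S>>%VS & B = M *m Q) (B \in span_mul S Q).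
Proof.
by apply: (iffP memv_imgP) => -[M SM ->]; exists M; rewrite ?lfunE.
Qed.

Definition centralizer n (A : 'M[k]_n) : {vspace 'M[k]_n} :=
  lker (linfun (mulmxr A) - linfun (mulmx A)).

Lemma centralizerP n (A B : 'M[k]_n) :
  reflect (B *m A = A *m B) (B \in centralizer A).
Proof.
rewrite memv_ker add_lfunE opp_lfunE !lfunE /= subr_eq0.
exact: eqP.
Qed.

End Spaces.

(* Main.v *)
Require Import Defs.
From HB Require Import structures.
From mathcomp Require Import all_boot all_algebra.

Set Implicit Arguments.
Unset Strict Implicit.
Unset Printing Implicit Defensive.

Import GRing.Theory.
Local Open Scope ring_scope.

(* A homomorphism k[x]/fj -> k[x]/fi is multiplication by some g with
   fi %| fj * g.  Writing fi = e * q and fj = e * r with q and r coprime, this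
   says that g = lambda * q, and g acts as 0 iff e divides lambda; so the
   homomorphisms are parametrized by the lambda of degree < deg e.  When one
   of fi, fj divides the other, q is the generating polynomial.  On matrices,
   multiplication by lambda * q is lambda(C(fi)) Q, since its s-th column is
   the image of x^s.  Commuting with the block diagonal matrix is a blockwise
   condition, which reduces the centralizer to these homomorphisms. *)

(** * Spans and free families of vectors *)

Section Families.
Variables (k : fieldType) (vT : vectType k).

(** Coefficients are functions on [nat] so that they can later be read as those of a polynomial
    [\poly_(l < d) c l]. *)
Lemma span_iotaP (F : nat -> vT) (d : nat) (v : vT) :
  v \in <<[seq F l | l <- iota 0 d]>>%VS <->
  exists c : nat -> k, v = \sum_(l < d) c l *: F l.
Proof.
set X := [seq F l | l <- iota 0 d].
have szX : size X == d by rewrite size_map size_iota.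
have nthX (l : 'I_d) : X`_l = F l.
  by rewrite (nth_map 0%N) ?size_iota // nth_iota.
split=> [vX|[c ->]]; last first.
  apply: memv_suml => l _; apply/memvZ/memv_span/map_f.
  by rewrite mem_iota ltn_ord.
exists (fun l => if insub l is Some i then coord (Tuple szX) i v else 0).
rewrite [LHS](coord_span (X := Tuple szX) vX).
by apply: eq_bigr => l _; rewrite valK nthX.
Qed.

Lemma free_iota (F : nat -> vT) (d : nat) :
  (forall c : nat -> k, \sum_(l < d) c l *: F l = 0 ->
     forall l : 'I_d, c l = 0) ->
  free [seq F l | l <- iota 0 d].
Proof.
move=> Finj; set X := [seq F l | l <- iota 0 d].
have szX : size X == d by rewrite size_map size_iota.
apply/(freeP (X := Tuple szX)) => c c0 l.
have := Finj (fun l => if insub l is Some i then c i else 0) _ l.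
rewrite valK; apply; rewrite -[RHS]c0; apply: eq_bigr => i _.
by rewrite valK /= (nth_map 0%N) ?size_iota // nth_iota.
Qed.

(** A linear map cannot raise dimension, so the span of [X] has dimension at least [size (map h X)],
    which is [size X]. *)
Lemma free_of_image (wT : vectType k) (h : 'Hom(vT, wT)) (X : seq vT) :
  free (map h X) -> free X.
Proof.
rewrite /free -limg_span size_map => /eqP dimhX.
by rewrite eqn_leq dim_span -dimhX -(limg_ker_dim h) leq_addl.
Qed.

End Families.

(** * Polynomials in a matrix *)

Lemma polymx_poly (k : fieldType) n (A : 'M[k]_n) (d : nat) (c : nat -> k) :
  polymx A (\poly_(l < d) c l) = \sum_(l < d) c l *: A ^+ l.
Proof.
case: n A => [|n] A; first by rewrite !flatmx0.
rewrite polymxE poly_def rmorph_sum /=; apply: eq_bigr => l _.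
by rewrite linearZ /= rmorphXn /= horner_mx_X.
Qed.

(** Used to upgrade an intertwining matrix from a k-linear to a k[x]-linear map. *)
Lemma intertwine_polymx (k : fieldType) p q (A : 'M[k]_p) (B : 'M[k]_q)
    (M : 'M[k]_(p, q)) (l : {poly k}) :
  M *m B = A *m M -> M *m polymx B l = polymx A l *m M.
Proof.
move=> MB; elim/poly_ind: l => [|l c IH].
  by rewrite -[0]/(0%:P) !polymxC mul_mx_scalar mul_scalar_mx.
rewrite !polymxD !polymxM !polymxC !polymxX mulmxDr mulmxDl mulmxA IH.
by rewrite -!mulmxA MB mul_mx_scalar mul_scalar_mx.
Qed.

Lemma span_mul_powersE (k : fieldType) p q (A : 'M[k]_p) (Q : 'M[k]_(p, q))
    (d : nat) :
  span_mul (powers A d) Q = <<[seq A ^+ l *m Q | l <- iota 0 d]>>%VS.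
Proof.
rewrite /span_mul limg_span -map_comp; congr <<_>>%VS.
by apply: eq_map => l; rewrite /= lfunE.
Qed.

Lemma span_mul_powersP (k : fieldType) p q (A : 'M[k]_p) (Q M : 'M[k]_(p, q))
    (d : nat) :
  M \in span_mul (powers A d) Q <->
  exists c : nat -> k, M = polymx A (\poly_(l < d) c l) *m Q.
Proof.
rewrite span_mul_powersE.
split=> [/span_iotaP[c ->]|[c ->]]; last apply/span_iotaP; exists c;
  by rewrite polymx_poly mulmx_suml; apply: eq_bigr => l _; rewrite scalemxAl.
Qed.

Lemma col_inj (R : Type) p q (A B : 'M[R]_(p, q)) :
  (forall s, col s A = col s B) -> A = B.
Proof.
by move=> AB; apply/matrixP => r s; have /colP/(_ r) := AB s; rewrite !mxE.
Qed.

(** * Orbits of the companion matrix *)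

Section CyclicMatrix.
Variables (k : fieldType) (f : {poly k}).
Hypothesis f_monic : f \is monic.

Local Notation n := (size f).-1.

Lemma compTinv_linear : linear (@compTinv k f).
Proof.
move=> p u v; apply: (can_inj (compTK f_monic)).
by rewrite compTinvK // raddfD /= compTZ // !compTinvK.
Qed.
HB.instance Definition _ := GRing.isLinear.Build {poly k} (polyquot f)
  (compmod f) *:%R (@compTinv k f) compTinv_linear.

(** The Krylov matrix of [u]. Indexing it by a class of the quotient turns left products with
    [polymx (companion f) p] into multiplication of classes. *)
Definition orbitmx (d : nat) (u : polyquot f) : 'M[k]_(n, d) :=
  \matrix_(r, s) (compTinv ('X^s *: u) : 'cV__) r 0.

Lemma col_orbitmx d (u : polyquot f) (s : 'I_d) :
  col s (orbitmx d u) = compTinv ('X^s *: u).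
Proof. by apply/colP => r; rewrite !mxE. Qed.

Lemma compTinvZ (p : {poly k}) (u : polyquot f) :
  compTinv (p *: u) = polymx (companion f) p *m (compTinv u : 'cV__).
Proof. by rewrite -[RHS]/(p *: compTinv u) -linearZ. Qed.

Lemma mul_polymx_orbitmx d (p : {poly k}) (u : polyquot f) :
  polymx (companion f) p *m orbitmx d u = orbitmx d (p *: u).
Proof.
apply: col_inj => s.
rewrite colE -mulmxA -colE !col_orbitmx scalerA mulrC -scalerA.
by rewrite [RHS]compTinvZ.
Qed.

Lemma orbitmx0 d : orbitmx d 0 = 0.
Proof. by apply: col_inj => s; rewrite col_orbitmx scaler0 linear0 col0. Qed.

(** Column 0 is the coordinate vector of [u] itself; with [d = 0] there would be no column to
    read. *)
Lemma orbitmx_eq0 d (u : polyquot f) : (0 < d)%N -> orbitmx d u = 0 -> u = 0.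
Proof.
move=> d_gt0 u0; have := col_orbitmx u (Ordinal d_gt0).
rewrite u0 col0 expr0 scale1r => /esym u0'.
by rewrite -(compTinvK f_monic u) [compTinv u]u0' raddf0.
Qed.

End CyclicMatrix.

Lemma compmod_scaleC (k : fieldType) (f : {poly k}) (c : k) (v : compmod f) :
  c%:P *: v = c *: (v : 'cV__) :> 'cV__.
Proof. by rewrite -mul_scalar_mx -(polymxC (companion f)). Qed.

(** * Module homomorphisms as intertwining matrices *)

Section Homs.
Variables (k : fieldType) (fi fj : {poly k}).
Hypotheses (fi_monic : fi \is monic) (fj_monic : fj \is monic).

Local Notation ni := (size fi).-1.
Local Notation nj := (size fj).-1.
Local Notation Ci := (companion fi).
Local Notation Cj := (companion fj).

Lemma col_hommx (phi : {linear polyquot fj -> polyquot fi}) (s : 'I_nj) :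
  col s (hommx phi) = compTinv (phi (compT (delta_mx s 0 : compmod fj))).
Proof. by apply/colP => r; rewrite !mxE. Qed.

Lemma mul_hommx (phi : {linear polyquot fj -> polyquot fi}) (v : 'cV[k]_nj) :
  hommx phi *m v = compTinv (phi (compT (v : compmod fj))).
Proof.
(* The scalars are constant polynomials because [compmod fj] is a module over k[x]. *)
have vE : v = \sum_s (v s 0)%:P *: (delta_mx s 0 : compmod fj) :> compmod fj.
  rewrite [LHS](matrix_sum_delta v); apply: eq_bigr => s _.
  by rewrite big_ord1 [RHS]compmod_scaleC.
pose h (w : compmod fj) := compTinv (phi (compT w)).
have h_lin : linear h.
  by move=> p u w; rewrite /h raddfD /= compTZ // linearP compTinv_linear.
pose H := GRing.isLinear.Build _ _ _ _ h h_lin.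
pose h' : {linear compmod fj -> compmod fi} := HB.pack h H.
rewrite [in RHS]vE -[RHS]/(h' _) [RHS]linear_sum.
rewrite {1}vE [LHS]mulmx_sumr; apply: eq_bigr => s _.
rewrite linearZ /= [in RHS]compmod_scaleC [X in _ *m X]compmod_scaleC
  -scalemxAr -colE.
by rewrite col_hommx.
Qed.

Lemma hommx_intertwine (phi : {linear polyquot fj -> polyquot fi}) :
  hommx phi *m Cj = Ci *m hommx phi.
Proof.
apply: col_inj => s; rewrite colE -mulmxA -colE mul_hommx.
rewrite [RHS]colE -mulmxA -colE col_hommx.
rewrite -[Ci](polymxX Ci) -compTinvZ // -linearZ -compTZ //.
congr (compTinv (phi (compT _))).
by rewrite colE compmod_scaleX.
Qed.

Lemma intertwine_hommx (M : 'M[k]_(ni, nj)) :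
  M *m Cj = Ci *m M ->
  exists phi : {linear polyquot fj -> polyquot fi}, M = hommx phi.
Proof.
(* Conjugation of [M] by the isomorphisms T inverts the construction of [hommx]. *)
move=> MC; pose h (u : polyquot fj) : polyquot fi :=
  compT (M *m (compTinv u : 'cV__) : compmod fi).
have h_lin : linear h.
  move=> p u v; rewrite /h compTinv_linear // -compTZ // -raddfD.
  congr compT; rewrite [LHS]mulmxDr; congr (_ + _).
  by rewrite [LHS]mulmxA (intertwine_polymx _ MC) -mulmxA.
pose H := GRing.isLinear.Build _ _ _ _ h h_lin.
pose phi : {linear polyquot fj -> polyquot fi} := HB.pack h H.
exists phi; apply: col_inj => s.
by rewrite col_hommx /phi /= /h !compTK // colE.
Qed.

(** The class of 1 generates the source: T maps [delta_mx s 0] to the class of x^s, whose image is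
    x^s times the image of 1. *)
Lemma hommx_orbitmx (phi : {linear polyquot fj -> polyquot fi}) :
  hommx phi = orbitmx nj (phi (polycl fj 1)).
Proof.
apply: col_inj => s; rewrite col_hommx col_orbitmx compT_delta -linearZ /=.
by rewrite polyclZ mulr1.
Qed.

End Homs.

(** * A single block, with [fi = e * q] and [fj = e * r] *)

Section Block.
Variables (k : fieldType) (fi fj e q r : {poly k}).
Hypotheses (fi_monic : fi \is monic) (fj_monic : fj \is monic).
Hypotheses (fiE : fi = e * q) (fjE : fj = e * r) (qr : coprimep q r).

Local Notation ni := (size fi).-1.
Local Notation nj := (size fj).-1.
Local Notation ne := (size e).-1.
Local Notation Ci := (companion fi).
Local Notation Q := (orbitmx nj (polycl fi q)).

Let eq_neq0 : (e != 0) && (q != 0).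
Proof. by rewrite -negb_or -mulf_eq0 -fiE monic_neq0. Qed.

Let e_neq0 : e != 0. Proof. by case/andP: eq_neq0. Qed.
Let q_neq0 : q != 0. Proof. by case/andP: eq_neq0. Qed.

Lemma polymx_mul_block (p : {poly k}) :
  polymx Ci p *m Q = orbitmx nj (polycl fi (p * q)).
Proof. by rewrite mul_polymx_orbitmx // polyclZ. Qed.

Lemma hommx_block (phi : {linear polyquot fj -> polyquot fi}) :
  exists p : {poly k}, hommx phi = polymx Ci p *m Q.
Proof.
set g := polyrep (phi (polycl fj 1)).
suff /divpK gE : q %| g.
  by exists (g %/ q); rewrite polymx_mul_block gE polyrepK hommx_orbitmx.
(* [fj] annihilates the class of 1, hence also its image, so [fi] divides [fj * g]. Cancelling [e]
   leaves [q] dividing [r * g], and coprimality gives [q %| g]. *)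
have : polycl fi (fj * g) == 0.
  rewrite -polyclZ polyrepK -linearZ polyclZ mulr1.
  suff -> : polycl fj fj = 0 by rewrite linear0.
  by apply/eqP; rewrite -(raddf0 (polycl fj)) polycl_eq subr0.
rewrite -(raddf0 (polycl fi)) polycl_eq subr0 fiE fjE -mulrA.
by rewrite dvdp_mul2l // Gauss_dvdpr.
Qed.

Lemma block_hommx (p : {poly k}) :
  exists phi : {linear polyquot fj -> polyquot fi},
    polymx Ci p *m Q = hommx phi.
Proof.
pose h (u : polyquot fj) : polyquot fi := polycl fi (p * q * polyrep u).
have hE g : h (polycl fj g) = polycl fi (p * q * g).
  (* Independence of the representative: two of them differ by a multiple of [fj], and [fi = e * q]
     divides [q * fj = q * (e * r)]. *)
  apply/eqP; rewrite polycl_eq -mulrBr -mulrA dvdp_mull //.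
  have /dvdpP[a ->] : fj %| polyrep (polycl fj g) - g.
    by rewrite -polycl_eq polyrepK.
  rewrite fiE fjE [e * q]mulrC; apply: dvdp_mul => //.
  exact: dvdp_mull (dvdp_mulIl _ _).
have h_lin : linear h.
  move=> c u v; rewrite -(polyrepK u) -(polyrepK v) polyclZ -raddfD !hE.
  by rewrite polyclZ -raddfD mulrDr mulrCA.
pose H := GRing.isLinear.Build _ _ _ _ h h_lin.
pose phi : {linear polyquot fj -> polyquot fi} := HB.pack h H.
exists phi; rewrite hommx_orbitmx // polymx_mul_block /phi /=.
by rewrite hE mulr1.
Qed.

Lemma polymx_block_eq0 (p : {poly k}) :
  polymx Ci p *m Q = 0 <-> e %| p.
Proof.
have cl0 : (polycl fi (p * q) == 0) = (e %| p).
  by rewrite -(raddf0 (polycl fi)) polycl_eq subr0 fiE dvdp_mul2r.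
rewrite polymx_mul_block -cl0; split=> [Q0|/eqP->]; last first.
  exact: orbitmx0.
(* If [nj = 0] the matrix has no columns and vanishes for every [p]; but then [fj] is a unit, so its
   divisor [e] divides everything. *)
have [nj0|nj_gt0] := posnP nj; last by rewrite (orbitmx_eq0 fi_monic nj_gt0 Q0).
rewrite cl0; apply: (dvdp_trans _ (dvd1p p)).
apply: dvdp_trans (dvdp_mulIl e r) _; rewrite -fjE dvdp1.
by rewrite -(prednK (n := size fj)) ?nj0 ?size_poly_gt0 ?monic_neq0.
Qed.

(** Multiples of [e] act as 0, so [p] may be replaced by its remainder modulo [e], which has at most
    [ne] coefficients. Hence all bounds [d] from [ne] on give the same space. *)
Lemma span_mul_blockP (d : nat) (M : 'M[k]_(ni, nj)) : (ne <= d)%N ->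
  (exists p : {poly k}, M = polymx Ci p *m Q) <->
  M \in span_mul (powers Ci d) Q.
Proof.
move=> le_d; split=> [[p ->]|/span_mul_powersP[c ->]]; last by eexists.
apply/span_mul_powersP; exists (fun l => (p %% e)`_l).
have -> : \poly_(l < d) (p %% e)`_l = p %% e.
  apply/polyP => l; rewrite coef_poly; case: ltnP => // le_l.
  rewrite nth_default // (leq_trans _ (leq_trans le_d le_l)) //.
  by rewrite -ltnS prednK ?size_poly_gt0 // ltn_modp.
apply/eqP; rewrite -subr_eq0 -mulmxBl; apply/eqP.
have -> : polymx Ci p - polymx Ci (p %% e) = polymx Ci (p %/ e * e).
  by rewrite {1}(divp_eq p e) polymxD addrK.
by apply/polymx_block_eq0; rewrite dvdp_mulIr.
Qed.

(** A linear relation is a polynomial of degree below that of [e] which kills [Q]; being divisible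
    by [e], it is 0. *)
Lemma free_block : free [seq Ci ^+ l *m Q | l <- iota 0 ne].
Proof.
apply: free_iota => c c0 l.
suff p0 : \poly_(l < ne) c l = 0.
  by move/polyP/(_ l): p0; rewrite coef_poly ltn_ord coef0.
apply/eqP; apply: contraTT isT => p_neq0.
have /polymx_block_eq0/(dvdp_leq p_neq0) :
    polymx Ci (\poly_(l < ne) c l) *m Q = 0.
  rewrite polymx_poly mulmx_suml -[RHS]c0; apply: eq_bigr => i _.
  by rewrite scalemxAl.
rewrite leqNgt -(prednK (n := size e)) ?size_poly_gt0 //.
by rewrite ltnS size_poly.
Qed.

(** The first [ne] members already span the same space, so its dimension is less than [d]. *)
Lemma nfree_block (d : nat) : (ne < d)%N ->
  ~~ free [seq Ci ^+ l *m Q | l <- iota 0 d].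
Proof.
move=> lt_d; rewrite /free size_map size_iota neq_ltn.
suff -> : <<[seq Ci ^+ l *m Q | l <- iota 0 d]>>%VS
        = <<[seq Ci ^+ l *m Q | l <- iota 0 ne]>>%VS.
  by rewrite (leq_ltn_trans (dim_span _)) // size_map size_iota.
rewrite -!span_mul_powersE; apply/vspaceP => M.
by apply/idP/idP => /span_mul_blockP-/(_ _)/span_mul_blockP; apply;
  rewrite // ltnW.
Qed.

End Block.

(** * Assembling a basis from blocks *)

(** The model is [h i] the projection to a block and [X i] matrices supported in that block. Since
    [h i] sees only [X i], applying it to a sum isolates one summand, and the [h i] together
    separate vectors. *)
Lemma joint_basis (k : fieldType) (I : finType) (vT : vectType k)
    (wT : I -> vectType k) (h : forall i, 'Hom(vT, wT i)) (X : I -> seq vT)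
    (U : {vspace vT}) :
    (forall v, (forall i, h i v = 0) -> v = 0) ->
    (forall i j v, i != j -> v \in X j -> h i v = 0) ->
    (forall i, free (map (h i) (X i))) ->
    (forall v, v \in U <-> forall i, h i v \in <<map (h i) (X i)>>%VS) ->
  basis_of U [seq x | i <- enum I, x <- X i].
Proof.
move=> h_inj hX0 freehX UP.
have {}hX0 i j v : i != j -> v \in <<X j>>%VS -> h i v = 0.
  move=> ne_ij vX; have /subvP/(_ _ vX) : (<<X j>> <= lker (h i))%VS.
    by apply/span_subvP => w wX; rewrite memv_ker (hX0 i j).
  by rewrite memv_ker => /eqP.
have hsum (us : I -> vT) i : (forall j, us j \in <<X j>>%VS) ->
    h i (\sum_j us j) = h i (us i).
  move=> usX; rewrite linear_sum (bigD1 i) //= big1 ?addr0 // => j ne_ji.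
  by rewrite (hX0 i j) // eq_sym.
have -> : [seq x | i <- enum I, x <- X i] = \big[cat/[::]]_i X i.
  have -> : index_enum I = enum I by rewrite [index_enum _]unlock -enumT.
  by elim: (enum I) => [|i s IH]; rewrite ?big_nil ?big_cons //= IH map_id.
have -> : U = (\sum_i <<X i>>)%VS.
  apply/vspaceP => v; apply/idP/memv_sumP => [/UP vU|[us usX ->]]; last first.
    apply/UP => i; rewrite hsum => [|j]; last exact: usX.
    by rewrite -limg_span memv_img ?usX.
  (* Each component of [v] is lifted to the span of [X i]; the difference between [v] and the sum of
     the lifts is killed by every [h i]. *)
  have us_ex i : exists u, u \in <<X i>>%VS /\ h i u = h i v.
    by have := vU i; rewrite -limg_span => /memv_imgP[u uX ->]; exists u.
  have [us usX] := fin_all_exists us_ex.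
  have usX1 i : us i \in <<X i>>%VS by case: (usX i).
  exists us => //; apply/eqP; rewrite -subr_eq0; apply/eqP/h_inj => i.
  by rewrite linearB /= hsum // (usX i).2 subrr.
apply: bigcat_basis => [|i _]; last first.
  by rewrite /basis_of eqxx; apply: free_of_image (freehX i).
(* Directness: applying [h i] to a vanishing sum leaves [h i (us i) = 0], while the other maps kill
   [us i] anyway. *)
apply/directv_sum_independent => us usX us0 i _; apply: h_inj => j.
have [->|ne_ji] := eqVneq j i; last by rewrite (hX0 j i) ?usX.
by rewrite -(hsum us) ?us0 ?linear0 // => l; apply: usX.
Qed.

Section BlockBasis.
Variables (k : fieldType) (p q : nat) (p_ : 'I_p -> nat) (q_ : 'I_q -> nat).

(** A name for the block projection, to carry the linear structure that [linfun] needs. *)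
Definition block i j (B : 'M[k]_(\sum_i p_ i, \sum_j q_ j)) :
  'M[k]_(p_ i, q_ j) := submxblock B i j.

Lemma block_linear i j : linear (block i j).
Proof. by move=> a B B'; apply/matrixP => r s; rewrite !mxE. Qed.
HB.instance Definition _ i j := GRing.isLinear.Build k
  'M[k]_(\sum_i p_ i, \sum_j q_ j) 'M[k]_(p_ i, q_ j) *:%R
  (block i j) (block_linear i j).

Lemma mxblock_basis (F : forall i j, nat -> 'M[k]_(p_ i, q_ j))
    (d : 'I_p -> 'I_q -> nat)
    (U : {vspace 'M[k]_(\sum_i p_ i, \sum_j q_ j)}) :
    (forall i j, free [seq F i j l | l <- iota 0 (d i j)]) ->
    (forall B, B \in U <-> forall i j,
       submxblock B i j \in <<[seq F i j l | l <- iota 0 (d i j)]>>%VS) ->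
  basis_of U [seq (\mxblock_(i, j)
                    (if (i == ij.1) && (j == ij.2) then F i j l else 0))
                  : 'M[k]_(\sum_i p_ i, \sum_j q_ j)
             | ij <- enum {: 'I_p * 'I_q}, l <- iota 0 (d ij.1 ij.2)].
Proof.
move=> freeF UP.
pose E (ij : 'I_p * 'I_q) l : 'M[k]_(\sum_i p_ i, \sum_j q_ j) :=
  \mxblock_(i, j) if (i == ij.1) && (j == ij.2) then F i j l else 0.
pose X ij := [seq E ij l | l <- iota 0 (d ij.1 ij.2)].
pose h (ij : 'I_p * 'I_q) := linfun (block ij.1 ij.2).
have hX ij : map (h ij) (X ij) =
    [seq F ij.1 ij.2 l | l <- iota 0 (d ij.1 ij.2)].
  rewrite -map_comp; apply: eq_map => l.
  by rewrite /= lfunE /= /block mxblockK !eqxx.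
have catX (r : seq ('I_p * 'I_q)) :
    [seq E ij l | ij <- r, l <- iota 0 (d ij.1 ij.2)] =
    [seq x | ij <- r, x <- X ij].
  by elim: r => //= ij r ->; rewrite map_id.
suff: basis_of U [seq x | ij <- enum {: 'I_p * 'I_q}, x <- X ij].
  by rewrite -catX.
apply: (joint_basis (h := h)) => [B B0|ij ij' B ne_ij /mapP[l _ ->]|ij|B].
- rewrite -(submxblockK B) -mxblock0; apply: eq_mxblock => i j.
  by have := B0 (i, j); rewrite lfunE.
- rewrite lfunE /= /block mxblockK; case: ifP => // /andP[/eqP e1 /eqP e2].
  by rewrite [ij]surjective_pairing e1 e2 -surjective_pairing eqxx in ne_ij.
- by rewrite hX.
- split=> [/UP BU ij|BU]; first by rewrite hX lfunE; apply: BU.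
  by apply/UP => i j; have := BU (i, j); rewrite hX lfunE.
Qed.

End BlockBasis.

(** * Generating matrices and the centralizer *)

Lemma generating_mxE (k : fieldType) (m : nat) (f : 'I_m -> {poly k}) i j :
  f i \is monic ->
  generating_mx f i j
  = orbitmx (size (f j)).-1 (polycl (f i) (generating_poly f i j)).
Proof.
move=> fi_monic; apply: col_inj => s; rewrite col_orbitmx compTinvZ //.
suff <- : companion (f i) ^+ s = polymx (companion (f i)) 'X^s.
  by apply/colP => r; rewrite !mxE.
elim: (s : nat) => [|l IH]; first by rewrite !expr0 polymx1.
by rewrite !exprS polymxM polymxX -IH.
Qed.

(** In a divisibility chain the polynomial of smaller index serves as [e], so one of the two
    cofactors is 1 and coprimality is immediate. *)
Lemma generating_polyP (k : fieldType) (m : nat) (f : 'I_m -> {poly k})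
    (i j : 'I_m) :
  (forall i, f i \is monic) ->
  (forall i j : 'I_m, (i <= j)%N -> f i %| f j) ->
  let e := if (i <= j)%N then f i else f j in
  exists r, [/\ f i = e * generating_poly f i j, f j = e * r
            & coprimep (generating_poly f i j) r].
Proof.
move=> f_monic f_dvd; rewrite /generating_poly /=; have [le_ij|lt_ji] := leqP.
  exists (f j %/ f i); rewrite mulr1 coprime1p; split=> //.
  by rewrite mulrC divpK ?f_dvd.
exists 1; rewrite mulr1 coprimep1; split=> //.
by rewrite mulrC divpK // f_dvd // ltnW.
Qed.

Theorem theorem3p1 (k : fieldType) (m : nat) (f : 'I_m -> {poly k})
    (f_monic : forall i, f i \is monic)
    (f_dvd : forall i j : 'I_m, (i <= j)%N -> f i %| f j) :
  let n := fun i => (size (f i)).-1 in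
  let C := fun i => companion (f i) in
  let Q := generating_mx f in
  let A : 'M[k]_(\sum_i n i) := \mxdiag_i C i in
  let d := fun i j : 'I_m => if (i <= j)%N then n i else n j in
  [/\ forall B : 'M[k]_(\sum_i n i),
        B \in centralizer A <->
        exists phi : forall i j, {linear polyquot (f j) -> polyquot (f i)},
          B = \mxblock_(i, j) hommx (phi i j),
      forall i j,
        (forall phi : {linear polyquot (f j) -> polyquot (f i)},
           exists lambda : {poly k},
             hommx phi = polymx (C i) lambda *m Q i j) /\
        (forall M : 'M[k]_(n i, n j),
           (exists lambda : {poly k}, M = polymx (C i) lambda *m Q i j) <->
           M \in span_mul (powers (C i) (n i)) (Q i j)),
      forall i j : 'I_m, (j < i)%N ->
        [/\ f i != f j -> ~~ free [seq C i ^+ l *m Q i j | l <- iota 0 (n i)],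
            span_mul (powers (C i) (n j)) (Q i j)
              = span_mul (powers (C i) (n i)) (Q i j)
          & free [seq C i ^+ l *m Q i j | l <- iota 0 (n j)]]
    & basis_of (centralizer A)
        [seq (\mxblock_(i', j')
                (if (i' == ij.1) && (j' == ij.2)
                 then C i' ^+ l *m Q i' j' else 0))
           : 'M[k]_(\sum_i n i)
        | ij <- enum {: 'I_m * 'I_m}, l <- iota 0 (d ij.1 ij.2)]].
Proof.
move=> n C Q A d.
pose e (i j : 'I_m) : {poly k} := if (i <= j)%N then f i else f j.
have dE (i j : 'I_m) : d i j = (size (e i j)).-1 by rewrite /d /e; case: ifP.
have dn (i j : 'I_m) : (d i j <= n i)%N.
  rewrite /d; case: (leqP i j) => [//|/ltnW] le_ji.
  by rewrite /n -!subn1 leq_sub2r // dvdp_leq ?monic_neq0 ?f_dvd.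
have homP i j (phi : {linear polyquot (f j) -> polyquot (f i)}) :
    exists p, hommx phi = polymx (C i) p *m Q i j.
  have [r [fiE fjE qr]] := generating_polyP i j f_monic f_dvd.
  by rewrite /Q generating_mxE //; apply: hommx_block fiE fjE qr phi.
have Phom i j p : exists phi : {linear polyquot (f j) -> polyquot (f i)},
    polymx (C i) p *m Q i j = hommx phi.
  have [r [fiE fjE qr]] := generating_polyP i j f_monic f_dvd.
  by rewrite /Q generating_mxE //; apply: block_hommx fiE fjE _.
have spanP i j t M : (d i j <= t)%N ->
    (exists p, M = polymx (C i) p *m Q i j) <->
    M \in span_mul (powers (C i) t) (Q i j).
  rewrite dE; have [r [fiE fjE qr]] := generating_polyP i j f_monic f_dvd.
  by rewrite /Q generating_mxE // => le_t; apply: (span_mul_blockP _ _ fiE fjE).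
have freeP i j : free [seq C i ^+ l *m Q i j | l <- iota 0 (d i j)].
  rewrite dE; have [r [fiE fjE qr]] := generating_polyP i j f_monic f_dvd.
  by rewrite /Q generating_mxE //; apply: (free_block _ _ fiE fjE).
(* As [A] is block diagonal, commuting with it says that each block intertwines [C j] and [C i]. *)
have centP B : B \in centralizer A <->
    forall i j, exists phi : {linear polyquot (f j) -> polyquot (f i)},
      submxblock B i j = hommx phi.
  rewrite -{1}(submxblockK B).
  split=> [/centralizerP|BC]; last apply/centralizerP;
    rewrite mul_mxblock_mxdiag mul_mxdiag_mxblock.
    by move=> /eq_mxblockP BC i j; exact: intertwine_hommx (BC i j).
  by apply: eq_mxblock => i j; have [phi ->] := BC i j; apply: hommx_intertwine.
split=> [B|i j|i j lt_ji|].
- split=> [/centP BC|[phi ->]]; last first.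
    by apply/centP => i j; exists (phi i j); rewrite mxblockK.
  (* Finite choice over both indices collects the homomorphisms into one family. *)
  have [phi phiE] := fin_all_exists (fun i => fin_all_exists (BC i)).
  by exists phi; rewrite -[LHS]submxblockK; apply: eq_mxblock.
- by split=> [phi|M]; [apply: homP | apply: spanP].
- have dij : d i j = n j by rewrite /d leqNgt lt_ji.
  split=> [ne_f||]; last by rewrite -dij.
    have [r [fiE fjE qr]] := generating_polyP i j f_monic f_dvd.
    rewrite /Q generating_mxE //; apply: (nfree_block _ _ fiE fjE) => //.
    (* A monic divisor of equal degree would be equal, so [f i != f j] forces [n j < n i]. *)
    rewrite -dE dij /n -ltnS !prednK ?size_poly_gt0 ?monic_neq0 //.
    have le_ji := f_dvd _ _ (ltnW lt_ji).
    rewrite ltn_neqAle dvdp_leq ?monic_neq0 // andbT dvdp_size_eqp //.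
    by rewrite eqp_monic // eq_sym.
  (* Both [n j] and [n i] are at least [d i j], so both spans consist of all products
     [polymx (C i) p *m Q i j]. *)
  by apply/vspaceP => M; apply/idP/idP => /spanP-/(_ _)/spanP; apply;
     rewrite // -dij.
- apply: (mxblock_basis (F := fun i j l => C i ^+ l *m Q i j)) => // B.
  split=> [/centP BC i j|BC]; last apply/centP => i j.
    have [phi ->] := BC i j; have [p ->] := homP i j phi.
    have : polymx (C i) p *m Q i j \in span_mul (powers (C i) (d i j)) (Q i j).
      by apply/spanP => //; exists p.
    by rewrite span_mul_powersE.
  suff /spanP[//|p ->] :
    submxblock B i j \in span_mul (powers (C i) (d i j)) (Q i j) by [].
  by rewrite span_mul_powersE; apply: BC.
Qed.
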